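(* Let $n,d,k$ be integers with $2\leq k\leq d-1\leq n-2$, let $K_n^k$ be the complete $k$-uniform hypergraph on $n$ vertices (all $k$-subsets of the vertex set are hyperedges), and let $p$ be a generic realisation of $K_n^k$ in $\mathbb R^d$. Then $(K_n^k,p)$ is volume rigid.
   Context: A hypergraph $H=(V,E)$ has a finite vertex set $V$ and a set $E$ of subsets of $V$ (hyperedges), each of size at least 2; it is $k$-uniform if every hyperedge has size $k$. A realisation of $H$ in $\mathbb R^d$ is a map $p:V\to\mathbb R^d$; it is generic if its $d|V|$ coordinates are algebraically independent over $\mathbb Q$. Equip $\bigwedge^k\mathbb R^d$ with the inner product $\langle x_1\wedge\dots\wedge x_k,y_1\wedge\dots\wedge y_k\rangle=\det[\langle x_i,y_j\rangle]_{i,j}$ and its norm $\|\cdot\|$. For $P=\{p_1,\dots,p_{k+1}\}\subset\mathbb R^d$ put $\mathrm{Vol}(P)=\frac{1}{k!}\|(p_2-p_1)\wedge\dots\wedge(p_{k+1}-p_1)\|$. Realisations $p,q$ are volume equivalent if $\mathrm{Vol}(p(\Delta))=\mathrm{Vol}(q(\Delta))$ for all $\Delta\in E$, and congruent if $q(v)=Ap(v)+t$ for all $v$, for some orthogonal $A$ and $t\in\mathbb R^d$. $(H,p)$ is volume rigid if there is a neighbourhood $N$ of $p$ in $\mathbb R^{d|V|}$ such that every $q\in N$ volume equivalent to $p$ is congruent to $p$. *)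

(* Defs.v *)
From HB Require Import structures.
From mathcomp Require Import all_boot all_order all_algebra.
From mathcomp Require Import reals.
From mathcomp Require Import mpoly.
Set Implicit Arguments. Unset Strict Implicit. Unset Printing Implicit Defensive.
Import Order.TTheory GRing.Theory Num.Theory.
Local Open Scope ring_scope.

Section Defs.
Variable R : realType.

Definition dotv (d : nat) (x y : 'rV[R]_d) : R := (x *m y^T) 0 0.

(* norm of x_0 /\ ... /\ x_(m-1) in the exterior power, via the induced inner
   product <x_1/\../\x_m, y_1/\../\y_m> = det [<x_i,y_j>] *)
Definition wedge_norm (d m : nat) (x : 'I_m -> 'rV[R]_d) : R :=
  Num.sqrt (\det (\matrix_(i, j) dotv (x i) (x j))).

Definition Vol (d : nat) (P : seq 'rV[R]_d) : R :=
  let m := (size P).-1 in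
  (m`!%:R)^-1 * wedge_norm (fun i : 'I_m => nth 0 P i.+1 - nth 0 P 0).

Definition edge_vol (n d : nat) (p : 'I_n -> 'rV[R]_d) (Delta : {set 'I_n}) : R :=
  Vol [seq p v | v <- enum Delta].

Definition complete_edge (n k : nat) (Delta : {set 'I_n}) : bool := #|Delta| == k.

Definition volume_equivalent (n d : nat) (E : {set 'I_n} -> bool)
  (p q : 'I_n -> 'rV[R]_d) : Prop :=
  forall Delta, E Delta -> edge_vol p Delta = edge_vol q Delta.

Definition congruent (n d : nat) (p q : 'I_n -> 'rV[R]_d) : Prop :=
  exists (A : 'M[R]_d) (t : 'rV[R]_d),
    A^T *m A = 1%:M /\ forall v, q v = p v *m A + t.

Definition coords (n d : nat) (p : 'I_n -> 'rV[R]_d) : 'I_(n * d) -> R :=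
  fun i => mxvec (\matrix_(v, j) p v 0 j) 0 i.

Definition generic (n d : nat) (p : 'I_n -> 'rV[R]_d) : Prop :=
  forall P : {mpoly rat[n * d]}, P != 0 ->
    meval (coords p) (map_mpoly (ratr : rat -> R) P) != 0.

(* volume rigidity: some neighbourhood (here a sup-norm ball, which generates
   the usual topology of R^{d|V|}) of p in which volume equivalence implies
   congruence *)
Definition volume_rigid (n d : nat) (E : {set 'I_n} -> bool)
  (p : 'I_n -> 'rV[R]_d) : Prop :=
  exists eps : R, 0 < eps /\
    forall q : 'I_n -> 'rV[R]_d,
      (forall v j, `|q v 0 j - p v 0 j| < eps) ->
      volume_equivalent E p q -> congruent p q.
End Defs.

(* Main.v *)
(* The squared volume of a k-subset S is, up to a constant, a determinant in the
   squared distances, so vol_S(p) - vol_S(q) = L_S(p, q) h, where h is the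
   difference of the squared distances and L_S(p, q) is a linear form whose
   coefficients are rational polynomials in p and q. Let T be a set of d + 1
   vertices. If p = q = x places T at a regular simplex, then L_S(x, x) h is a
   nonzero multiple of the sum of h over the pairs contained in S, and these sums
   determine h because 2 <= k <= |T| - 2. Hence det (L(p, p)^T L(p, q)) is not
   the zero polynomial; at a generic p it is nonzero on the diagonal, hence for
   all q near p, and then equal volumes force equal distances on T. Any two
   vertices lie in such a T, and equal distances force congruence. *)
Require Import Defs.
From HB Require Import structures.
From mathcomp Require Import all_boot all_order all_algebra.
From mathcomp Require Import reals mpoly.
From mathcomp Require Import ring lra zify.
Set Implicit Arguments. Unset Strict Implicit. Unset Printing Implicit Defensive.
Import Order.TTheory GRing.Theory Num.Theory.
Local Open Scope ring_scope.

Lemma exists_set_between (T : finType) (A B : {set T}) m :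
  A \subset B -> (#|A| <= m <= #|B|)%N ->
  exists C : {set T}, [/\ A \subset C, C \subset B & #|C| = m].
Proof.
move=> sAB /andP[Am mB].
have : (m - #|A| <= #|B :\: A|)%N.
  by rewrite cardsD (setIidPr sAB) leq_sub2r.
case/card_geqP=> s [us szs sBA].
exists (A :|: [set x in s]); split.
- exact: subsetUl.
- rewrite subUset sAB; apply/subsetP=> x; rewrite inE => /sBA.
  by rewrite inE => /andP[].
- rewrite cardsU (_ : A :&: _ = set0) ?cards0 ?subn0.
    by rewrite cardsE (card_uniqP us) szs subnKC.
  apply/setP=> x; rewrite !inE; apply/negP=> /andP[xA /sBA].
  by rewrite inE xA.
Qed.

(** * Sums over k-subsets determine a function on pairs *)

Section PairInclusion.
Variables (K : numFieldType) (V : finType) (T : {set V}) (g : V -> V -> K) (k : nat).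
Hypotheses (k2 : (2 <= k)%N) (kT : (k + 2 <= #|T|)%N).
Hypotheses (gC : forall u v, g u v = g v u) (g0 : forall u, g u u = 0).
Hypothesis gS : forall S : {set V}, S \subset T -> #|S| = k ->
  \sum_(u in S) \sum_(v in S) g u v = 0.

Let r (A : {set V}) x := \sum_(a in A) g a x.

Lemma pair_sum_setU1 (A : {set V}) x : x \notin A ->
  \sum_(u in x |: A) \sum_(v in x |: A) g u v =
  \sum_(u in A) \sum_(v in A) g u v + r A x *+ 2.
Proof.
move=> xA; rewrite big_setU1 //= big_setU1 //= g0 add0r.
under [X in _ + X]eq_bigr do rewrite big_setU1 //=.
rewrite big_split /= addrA addrC; congr (_ + _).
by rewrite mulr2n /r; congr (_ + _); apply: eq_bigr => *; rewrite gC.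
Qed.

(** Both [x |: A] and [y |: A] are k-subsets of [T]; comparing their vanishing sums cancels the part
    inside [A]. *)
Lemma pair_sum_link (A : {set V}) x y : x \in T -> y \in T -> A \subset T ->
  #|A| = k.-1 -> x \notin A -> y \notin A -> r A x = r A y.
Proof.
move=> xT yT AT cA xA yA.
have H z : z \in T -> z \notin A ->
    \sum_(u in A) \sum_(v in A) g u v + r A z *+ 2 = 0.
  move=> zT zA; rewrite -pair_sum_setU1 //; apply: gS.
    by rewrite subUset sub1set zT.
  by rewrite cardsU1 zA cA; case: (k) k2.
have /eqP : r A x *+ 2 = r A y *+ 2.
  by apply: (addrI (\sum_(u in A) \sum_(v in A) g u v)); rewrite !H.
by rewrite eqrMn2r /= => /eqP.
Qed.

(** Choose [B] of size k - 2 in [T] avoiding the four points, which k + 2 <= |T| allows. Then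
    [pair_sum_link] for [t |: B] gives [g t x - g t y = r B y - r B x], and the right side is the
    same for [t = z] and [t = w]. *)
Lemma pair_sum_exchange x y z w : uniq [:: x; y; z; w] ->
  all (mem T) [:: x; y; z; w] -> g z x - g z y = g w x - g w y.
Proof.
rewrite /= !inE !negb_or => /and4P[/and3P[xy xz xw] /andP[yz yw] zw _].
case/and5P=> xT yT zT wT _.
have [|B [_ BT cB]] := @exists_set_between _ set0 (T :\: [set x; y; z; w]) (k - 2) (sub0set _).
  rewrite cards0 /= cardsD.
  have -> : T :&: [set x; y; z; w] = [set x; y; z; w].
    by apply/setIidPr; rewrite !subUset !sub1set xT yT zT wT.
  have -> : #|[set x; y; z; w]| = 4.
    by rewrite -!setUA !cardsU1 cards1 !inE !negb_or xy xz xw yz yw zw.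
  by lia.
have nB t : t \in [set x; y; z; w] -> t \notin B.
  by move=> tS; apply/negP=> /(subsetP BT); rewrite inE tS.
have {}BT : B \subset T by apply: subset_trans BT (subsetDl _ _).
have H t : t \in T -> t \notin B -> x != t -> y != t -> g t x - g t y = r B y - r B x.
  move=> tT tB xt yt; have := @pair_sum_link (t |: B) x y xT yT.
  rewrite subUset sub1set tT BT cardsU1 tB cB !inE (negPf xt) (negPf yt).
  move/(_ isT); rewrite (_ : true + (k - 2) = k.-1)%N; last by lia.
  move=> /(_ erefl); rewrite !nB ?inE ?eqxx ?orbT // => /(_ isT isT).
  by rewrite /r !big_setU1 //= => E; rewrite -[g t x](addrK (r B x)) E /r; ring.
by rewrite !H ?nB ?inE ?eqxx ?orbT.
Qed.

(** In [r A x = r A y] with [a] in [A], the k - 1 termwise differences all equal [g a x - g a y] by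
    [pair_sum_exchange], so this difference is 0. *)
Lemma pair_sum_move x y a : uniq [:: x; y; a] -> all (mem T) [:: x; y; a] ->
  g a x = g a y.
Proof.
rewrite /= !inE !negb_or => /and3P[/andP[xy xa] ya _] /and4P[xT yT aT _].
have [||A [aA AT cA]] := @exists_set_between _ [set a] (T :\: [set x; y]) k.-1.
- by rewrite sub1set !inE negb_or aT eq_sym xa eq_sym ya.
- rewrite cards1 cardsD.
  have -> : T :&: [set x; y] = [set x; y].
    by apply/setIidPr; rewrite subUset !sub1set xT yT.
  rewrite cards2 xy; lia.
have {}aA : a \in A by move: aA; rewrite sub1set.
have xA : x \notin A by apply/negP=> /(subsetP AT); rewrite !inE eqxx.
have yA : y \notin A by apply/negP=> /(subsetP AT); rewrite !inE eqxx orbT.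
have {}AT : A \subset T by apply: subset_trans AT (subsetDl _ _).
have : r A x - r A y = 0 by apply/eqP; rewrite subr_eq0; apply/eqP/pair_sum_link.
rewrite /r -sumrB (eq_bigr (fun=> g a x - g a y)) => [|b bA]; last first.
  have [->//|ba] := eqVneq b a.
  apply: pair_sum_exchange; rewrite /= ?xT ?yT ?aT ?(subsetP AT) //.
  rewrite !inE !negb_or xy xa ya ba !andbT.
  by apply/andP; split; [apply: contraNneq xA | apply: contraNneq yA] => ->.
rewrite sumr_const cA => /eqP; rewrite mulrn_eq0 subr_eq0 => /orP[|/eqP//].
by case: (k) k2 => [|[|m]].
Qed.

(** Moving one endpoint at a time makes [g] constant on pairs of distinct points of [T]; the sum
    over a k-subset is then k (k - 1) times that constant. *)
Lemma pair_sum_inj u v : u \in T -> v \in T -> g u v = 0.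
Proof.
move=> uT vT; have [->//|uv] := eqVneq u v.
have [||S [_ ST cS]] := @exists_set_between _ [set u; v] T k.
- by rewrite subUset !sub1set uT.
- by rewrite cards2 uv k2 /=; apply: leq_trans kT; rewrite leq_addr.
have E a b : a \in T -> b \in T -> a != b -> g a b = g u v.
  move=> aT bT ab.
  have [au|au] := eqVneq a u.
    rewrite au in aT ab *; have [->//|bv] := eqVneq b v.
    by apply: pair_sum_move; rewrite /= ?aT ?bT ?uT ?vT // !inE !negb_or bv eq_sym ab eq_sym uv.
  have [bu|bu] := eqVneq b u.
    rewrite gC bu; have [->//|av] := eqVneq a v.
    by apply: pair_sum_move; rewrite /= ?aT ?bT ?uT ?vT // !inE !negb_or av au eq_sym uv.
  transitivity (g a u).
    by apply: pair_sum_move; rewrite /= ?aT ?bT ?uT ?vT // !inE !negb_or bu eq_sym ab eq_sym au.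
  rewrite gC; have [->//|av] := eqVneq a v.
  by apply: pair_sum_move; rewrite /= ?aT ?bT ?uT ?vT // !inE !negb_or av au eq_sym uv.
have := gS ST cS.
rewrite (eq_bigr (fun=> g u v *+ k.-1)) => [|a aS]; last first.
  rewrite (bigD1 a) //= g0 add0r (eq_bigr (fun=> g u v)) => [|b /andP[bS ba]].
    rewrite sumr_const -cS (cardD1 a (mem S)) aS /=; congr (_ *+ _).
    by apply: eq_card => b; rewrite !inE andbC.
  by rewrite E ?(subsetP ST) // eq_sym.
rewrite sumr_const cS => /eqP; rewrite !mulrn_eq0.
by case: (k) k2 => [|[|m]] //= _ /eqP.
Qed.

End PairInclusion.

(** * Exact difference of two determinants *)

Section DetDifference.
Variables (K : comRingType) (m : nat).
Implicit Types A B : 'M[K]_m.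

Definition mix_rows (t : nat) A B : 'M[K]_m :=
  \matrix_(i, j) if (i < t)%N then A i j else B i j.

(** Telescoping over the number of rows taken from [A]: consecutive mixed matrices differ in one
    row, and expansion along it uses the same cofactors. *)
Lemma det_difference A B :
  \det A - \det B =
  \sum_i \sum_j (A i j - B i j) * cofactor (mix_rows i A B) i j.
Proof.
have -> : \det A = \det (mix_rows m A B).
  by congr (\det _); apply/matrixP=> i j; rewrite mxE ltn_ord.
have -> : \det B = \det (mix_rows 0 A B).
  by congr (\det _); apply/matrixP=> i j; rewrite mxE ltn0.
rewrite -(@telescope_sumr _ 0 m (fun t => \det (mix_rows t A B))) // big_mkord.
apply: eq_bigr => i _; rewrite (expand_det_row (mix_rows i.+1 A B) i).
rewrite (expand_det_row (mix_rows i A B) i) -sumrB; apply: eq_bigr => j _.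
have -> : cofactor (mix_rows i.+1 A B) i j = cofactor (mix_rows i A B) i j.
  congr (_ * \det _); apply/matrixP=> a b; rewrite !mxE ltnS leq_eqVlt.
  by rewrite (inj_eq val_inj) eq_sym (negPf (neq_lift i a)).
by rewrite !mxE ltnSn ltnn mulrBl.
Qed.

End DetDifference.

(** * Differences of Gram determinants as linear forms *)

Section GramForm.
Variables (K : numFieldType) (V : eqType) (v0 : V).
Implicit Types (D g : V -> V -> K) (s : seq V).

(* By polarization, twice the Gram matrix of the edges issued from the first
   point of s when D is a squared distance. *)
Definition gram_of D s : 'M[K]_((size s).-1) :=
  \matrix_(i, j) (D (nth v0 s i.+1) (nth v0 s 0) + D (nth v0 s j.+1) (nth v0 s 0)
                  - D (nth v0 s i.+1) (nth v0 s j.+1)).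

(** The linear form L_S, up to a constant. For [D = D'] it is the derivative of the Gram determinant
    at [D] in the direction [g]. *)
Definition gram_diff D D' s g : K :=
  \sum_i \sum_j gram_of g s i j *
    cofactor (mix_rows i (gram_of D s) (gram_of D' s)) i j.

Lemma gram_diff_ext D D' g g' s :
  {in s &, g =2 g'} -> gram_diff D D' s g = gram_diff D D' s g'.
Proof.
move=> gg; apply: eq_bigr => i _; apply: eq_bigr => j _; congr (_ * _).
have lt_s (a : 'I_(size s).-1) : (a.+1 < size s)%N by case: a; case: (s).
have s0 : (0 < size s)%N by apply: leq_trans (lt_s i).
by rewrite !mxE !gg ?mem_nth.
Qed.

Lemma gram_diffE D D' s :
  \det (gram_of D s) - \det (gram_of D' s) =
  gram_diff D D' s (fun u v => D u v - D' u v).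
Proof.
rewrite det_difference; apply: eq_bigr => i _; apply: eq_bigr => j _.
by congr (_ * _); rewrite !mxE; ring.
Qed.

(** Linearity, in the shape that makes the form a row of a linear system: its coefficients are its
    values on the [F a]. *)
Lemma gram_diff_sum (I : finType) (F : I -> V -> V -> K) (c : I -> K) D D' s :
  gram_diff D D' s (fun u v => \sum_a c a * F a u v) =
  \sum_a gram_diff D D' s (F a) * c a.
Proof.
rewrite /gram_diff; under [RHS]eq_bigr do rewrite mulr_suml.
rewrite [RHS]exchange_big; apply: eq_bigr => i _ /=.
under [RHS]eq_bigr do rewrite mulr_suml.
rewrite [RHS]exchange_big; apply: eq_bigr => j _ /=.
rewrite !mxE -big_split -sumrB mulr_suml; apply: eq_bigr => a _ /=.
by rewrite !mxE; ring.
Qed.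

(** By Jacobi's formula the form is det B times the trace of the inverse of [B] times the Gram
    matrix of [g]; for a regular simplex the explicit inverse weighs all pairs equally. *)
Lemma gram_diff_regular D s g : uniq s ->
  {in s &, forall u v, D u v = 2 * (u != v)%:R} ->
  (forall u v, g u v = g v u) -> (forall u, g u u = 0) ->
  gram_diff D D s g = 0 -> \sum_(u <- s) \sum_(v <- s) g u v = 0.
Proof.
case: s => [|e s]; first by rewrite big_nil.
rewrite /gram_diff; set B := gram_of D _; move=> /= /andP[es us] DE gC g0.
set m := size s in B *.
have [k k0 mE] : exists2 k : K, k != 0 & m%:R = k - 1.
  by exists m.+1%:R; rewrite ?pnatr_eq0 // -addn1 natrD addrK.
(* B = 2 (I + J) with J the all-one matrix, so its inverse is (I - J / k) / 2. *)
pose C : 'M[K]_m := \matrix_(i, j) (((i == j)%:R - k^-1) / 2).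
have BE : B = \matrix_(i, j) (2 + 2 * (i == j)%:R).
  apply/matrixP=> i j; rewrite !mxE /=.
  have is_ : nth v0 s i \in s by rewrite mem_nth.
  have js : nth v0 s j \in s by rewrite mem_nth.
  have ne l : nth v0 s l \in s -> nth v0 s l != e by apply: contraTneq => ->.
  rewrite !DE ?inE ?is_ ?js ?eqxx ?orbT // nth_uniq // !ne //.
  by rewrite (inj_eq val_inj); case: eqP => _ /=; ring.
have BC : B *m C = 1%:M.
  apply/matrixP=> i j; rewrite !mxE BE.
  under eq_bigr do rewrite !mxE.
  rewrite (eq_bigr (fun l : 'I_m => ((l == j)%:R - k^-1) +
      (i == l)%:R * ((l == j)%:R - k^-1))) => [|l _]; last by field.
  rewrite big_split /= sumrB (bigD1 j) //= eqxx big1 ?addr0; last first.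
    by move=> l /negPf->.
  rewrite [X in _ + X](bigD1 i) //= eqxx [X in _ + (_ + X)]big1 ?addr0; last first.
    by move=> l; rewrite eq_sym => /negPf->; rewrite mul0r.
  rewrite sumr_const card_ord -[k^-1 *+ m]mulr_natr.
  by rewrite mE mul1r; field.
have [uB _] := mulmx1_unit BC.
have adjE : \adj B = \det B *: C.
  by rewrite -[LHS]mulmx1 -BC mulmxA mul_adj_mx mul_scalar_mx.
pose a (i : 'I_m) := g (nth v0 s i) e.
pose h (i j : 'I_m) := g (nth v0 s i) (nth v0 s j).
(* This is twice the trace. The identity part gives 2 sum a, the all-one part 2 m sum a - sum h, and
   m = k - 1 leaves equal weights. *)
have ahE : \sum_i \sum_j (a i + a j - h i j) * ((i == j)%:R - k^-1) =
    (2 * \sum_i a i + \sum_i \sum_j h i j) / k.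
  transitivity (\sum_i \sum_j (a i + a j - h i j) * (i == j)%:R
      - k^-1 * \sum_i \sum_j (a i + a j - h i j)).
    rewrite mulr_sumr -sumrB; apply: eq_bigr => i _.
    rewrite mulr_sumr -sumrB; apply: eq_bigr => j _.
    by ring.
  have -> : \sum_i \sum_j (a i + a j - h i j) * (i == j)%:R = 2 * \sum_i a i.
    rewrite mulr_sumr; apply: eq_bigr => i _.
    rewrite (bigD1 i) //= big1 ?addr0 => [|j]; last first.
      by rewrite eq_sym => /negPf->; rewrite mulr0.
    by rewrite eqxx mulr1 /h g0; ring.
  have -> : \sum_i \sum_j (a i + a j - h i j) =
      2 * m%:R * (\sum_i a i) - \sum_i \sum_j h i j.
    under eq_bigr do rewrite sumrB big_split /= sumr_const card_ord.
    rewrite sumrB big_split /= sumr_const card_ord -mulr_natr.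
    under eq_bigr do rewrite -mulr_natr.
    by rewrite -mulr_suml; ring.
  by rewrite mE; field.
have -> : \sum_i \sum_j gram_of g (e :: s) i j *
      cofactor (mix_rows i B B) i j =
    \det B / 2 * ((2 * \sum_i a i + \sum_i \sum_j h i j) / k).
  rewrite -ahE mulr_sumr; apply: eq_bigr => i _.
  rewrite mulr_sumr; apply: eq_bigr => j _.
  have -> : mix_rows i B B = B by apply/matrixP=> ? ?; rewrite mxE if_same.
  have -> : cofactor B i j = (\adj B) j i by rewrite mxE.
  rewrite adjE !mxE /= eq_sym mulrCA -[RHS]mulrA; congr (_ * _).
  by rewrite [RHS]mulrCA; congr (_ * _); rewrite mulrC.
move/eqP; rewrite !mulf_eq0 !invr_eq0 (negPf k0) orbF.
rewrite pnatr_eq0 orbF => /orP[|/eqP E].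
  by move=> /eqP dB; rewrite unitmxE dB unitr0 in uB.
rewrite big_cons big_cons g0 add0r.
under [X in _ + X]eq_bigr do rewrite big_cons.
rewrite big_split /= -[RHS]E !(big_nth v0) !big_mkord -/m.
under [X in X + _]eq_bigr do rewrite gC.
rewrite addrA -mulr2n mulr_natl; congr (_ + _).
by apply: eq_bigr => i _; rewrite (big_nth v0) big_mkord.
Qed.

End GramForm.

(** * Neighbourhoods, polynomials in two configurations, genericity *)

Section Configurations.
Variables (R : realType) (n d : nat).
Notation conf := ('I_n -> 'rV[R]_d).

(** The same ball as in [volume_rigid], so that rigidity is itself a [nearby] statement. *)
Definition nearby (p : conf) (Q : conf -> Prop) : Prop :=
  exists eps : R, 0 < eps /\
    forall q : conf, (forall v j, `|q v 0 j - p v 0 j| < eps) -> Q q.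

Lemma nearby_imp p (Q Q' : conf -> Prop) :
  (forall q, Q q -> Q' q) -> nearby p Q -> nearby p Q'.
Proof. by move=> QQ' [e [e0 He]]; exists e; split=> // q /He/QQ'. Qed.

Lemma nearby_and p (Q Q' : conf -> Prop) :
  nearby p Q -> nearby p Q' -> nearby p (fun q => Q q /\ Q' q).
Proof.
move=> [e [e0 He]] [f [f0 Hf]]; exists (Num.min e f); rewrite lt_min e0 f0.
split=> // q Hq; split; [apply: He | apply: Hf] => v j;
  by move: (Hq v j); rewrite lt_min => /andP[].
Qed.

Lemma nearby_all p (I : finType) (Q : I -> conf -> Prop) :
  (forall i, nearby p (Q i)) -> nearby p (fun q => forall i, Q i q).
Proof.
move=> H; suff: nearby p (fun q => forall i, i \in enum I -> Q i q).
  by apply: nearby_imp => q Hq i; apply: Hq; rewrite mem_enum.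
elim: (enum I) => [|i s IH]; first by exists 1.
apply: nearby_imp (nearby_and (H i) IH) => q [Hi Hs] j.
by rewrite inE => /predU1P[->|/Hs].
Qed.

(** Rational polynomial functions of two configurations. As an inductive closure, they get
    continuity and restriction to the diagonal by induction; [bipoly_ext] allows pointwise
    rewriting. *)
Inductive bipoly : (conf -> conf -> R) -> Prop :=
| bipoly_ext F G : (forall p q, F p q = G p q) -> bipoly F -> bipoly G
| bipoly_left v j : bipoly (fun p _ => p v 0 j)
| bipoly_right v j : bipoly (fun _ q => q v 0 j)
| bipoly_const (c : rat) : bipoly (fun _ _ => ratr c)
| bipolyD F G : bipoly F -> bipoly G -> bipoly (fun p q => F p q + G p q)
| bipolyM F G : bipoly F -> bipoly G -> bipoly (fun p q => F p q * G p q).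

Lemma bipoly_int (c : int) : bipoly (fun _ _ => c%:~R).
Proof.
by apply: bipoly_ext (bipoly_const c%:~R) => p q; rewrite ratr_int.
Qed.

Lemma bipolyN F : bipoly F -> bipoly (fun p q => - F p q).
Proof.
move=> HF; apply: bipoly_ext (bipolyM (bipoly_int (-1)) HF) => p q.
by rewrite mulrN1z mulN1r.
Qed.

Lemma bipolyB F G : bipoly F -> bipoly G -> bipoly (fun p q => F p q - G p q).
Proof. by move=> HF HG; apply: bipolyD => //; apply: bipolyN. Qed.

Lemma bipoly_sum (I : Type) (r : seq I) (P : pred I) F :
  (forall i, bipoly (F i)) -> bipoly (fun p q => \sum_(i <- r | P i) F i p q).
Proof.
move=> HF; elim: r => [|i r IH].
  by apply: bipoly_ext (bipoly_int 0) => p q; rewrite big_nil.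
case Pi: (P i); last first.
  by apply: bipoly_ext IH => p q; rewrite big_cons Pi.
by apply: bipoly_ext (bipolyD (HF i) IH) => p q; rewrite big_cons Pi.
Qed.

Lemma bipoly_prod (I : Type) (r : seq I) (P : pred I) F :
  (forall i, bipoly (F i)) -> bipoly (fun p q => \prod_(i <- r | P i) F i p q).
Proof.
move=> HF; elim: r => [|i r IH].
  by apply: bipoly_ext (bipoly_int 1) => p q; rewrite big_nil.
case Pi: (P i); last first.
  by apply: bipoly_ext IH => p q; rewrite big_cons Pi.
by apply: bipoly_ext (bipolyM (HF i) IH) => p q; rewrite big_cons Pi.
Qed.

Lemma bipoly_sign m : bipoly (fun _ _ => (-1) ^+ m).
Proof.
apply: bipoly_ext (bipoly_int ((-1) ^+ m)) => p q.
by rewrite rmorphXn /= rmorphN1.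
Qed.

Lemma bipoly_det m (M : conf -> conf -> 'M[R]_m) :
  (forall i j, bipoly (fun p q => M p q i j)) -> bipoly (fun p q => \det (M p q)).
Proof.
move=> HM; apply: bipoly_sum => s; apply: bipolyM; first exact: bipoly_sign.
by apply: bipoly_prod.
Qed.

Lemma bipoly_cofactor m (M : conf -> conf -> 'M[R]_m) i j :
  (forall i j, bipoly (fun p q => M p q i j)) ->
  bipoly (fun p q => cofactor (M p q) i j).
Proof.
move=> HM; apply: bipolyM; first exact: bipoly_sign.
apply: bipoly_det => a b.
by apply: bipoly_ext (HM (lift i a) (lift j b)) => p q; rewrite !mxE.
Qed.

Lemma bipoly_diag F : bipoly F -> bipoly (fun p _ => F p p).
Proof.
elim=> {F} [F G E _ IH|v j|v j|c|F G _ IF _ IG|F G _ IF _ IG].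
- by apply: bipoly_ext IH => p q.
- exact: bipoly_left.
- exact: bipoly_left.
- exact: bipoly_const.
- exact: bipolyD.
- exact: bipolyM.
Qed.

Lemma bipoly_swap F : bipoly F -> bipoly (fun p q => F q p).
Proof.
elim=> {F} [F G E _ IH|v j|v j|c|F G _ IF _ IG|F G _ IF _ IG].
- by apply: bipoly_ext IH => p q.
- exact: bipoly_right.
- exact: bipoly_left.
- exact: bipoly_const.
- exact: bipolyD.
- exact: bipolyM.
Qed.

Lemma bipoly_continuous F p (e : R) : bipoly F -> 0 < e ->
  nearby p (fun q => `|F p q - F p p| < e).
Proof.
move=> HF; elim: HF e => {F} [F G E _ IH|v j|v j|c|F G _ IF _ IG|F G _ IF _ IG] e e0.
- by apply: nearby_imp (IH _ e0) => q; rewrite !E.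
- by exists 1; split=> // q _; rewrite subrr normr0.
- by exists e; split=> // q; apply.
- by exists 1; split=> // q _; rewrite subrr normr0.
- have e2 : 0 < e / 2 by rewrite divr_gt0.
  apply: nearby_imp (nearby_and (IF _ e2) (IG _ e2)) => q [].
  set a := F p q; set b := F p p; set c := G p q; set b' := G p p => Ha Hc.
  have -> : a + c - (b + b') = (a - b) + (c - b') by ring.
  by apply: le_lt_trans (ler_normD _ _) _; lra.
- set b := F p p; set b' := G p p.
  (* With |a - b| < 1 and both errors below e / M, the three products below add up to less than (1 +
     |b| + |b'|) e / M = e. *)
  pose M := 1 + `|b| + `|b'|.
  have M0 : 0 < M by rewrite /M; have := normr_ge0 b; have := normr_ge0 b'; lra.
  have eM : 0 < e / M by rewrite divr_gt0.
  have H1 := nearby_and (IF 1 ltr01) (nearby_and (IF _ eM) (IG _ eM)).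
  apply: nearby_imp H1 => q []; rewrite -/b -/b'.
  set a := F p q; set c := G p q => H1 [Ha Hc].
  have -> : a * c - b * b' = (a - b) * (c - b') + b * (c - b') + b' * (a - b) by ring.
  apply: le_lt_trans (ler_normD _ _) _.
  apply: le_lt_trans (lerD (ler_normD _ _) (lexx _)) _.
  rewrite !normrM.
  have -> : e = e / M + `|b| * (e / M) + `|b'| * (e / M).
    by rewrite -[in LHS](divfK (lt0r_neq0 M0) e) {2}/M; ring.
  apply: ltr_leD; last by apply: ler_wpM2l => //; apply: ltW.
  apply: ltr_leD; last by apply: ler_wpM2l => //; apply: ltW.
  apply: le_lt_trans Hc; rewrite -[leRHS]mul1r; apply: ler_wpM2r => //.
  exact: ltW.
Qed.

Lemma bipoly_mpoly F : bipoly F -> exists P : {mpoly rat[n * d]},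
  forall p, F p p = meval (coords p) (map_mpoly (ratr : rat -> R) P).
Proof.
have X v j : exists P : {mpoly rat[n * d]},
    forall p : conf, p v 0 j = meval (coords p) (map_mpoly (ratr : rat -> R) P).
  exists 'X_(mxvec_index v j) => p.
  by rewrite map_mpolyX mevalXU /coords mxvecE mxE.
elim=> {F} [F G E _ [P HP]|v j|v j|c|F G _ [P HP] _ [Q HQ]|F G _ [P HP] _ [Q HQ]].
- by exists P => p; rewrite -E.
- exact: X.
- exact: X.
- by exists c%:MP => p; rewrite map_mpolyC mevalC.
- by exists (P + Q) => p; rewrite HP HQ rmorphD mevalD.
- by exists (P * Q) => p; rewrite HP HQ rmorphM mevalM.
Qed.

(** On the diagonal [F] is one rational polynomial in the coordinates, and its value at [x] shows
    that it is not the zero polynomial. *)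
Lemma generic_bipoly_neq0 F p x : bipoly F -> generic p -> F x x != 0 -> F p p != 0.
Proof.
move=> /bipoly_mpoly[P HP] gp Fx; rewrite HP; apply: gp.
by apply: contraNneq Fx => P0; rewrite HP P0 rmorph0 meval0.
Qed.

(* If the linear system with matrix L(p, q) is injective at one diagonal point
   (x, x), the polynomial det (L(p, p)^T L(p, q)) does not vanish there, hence
   neither at a generic (p, p) nor at nearby (p, q). *)
Lemma generic_linear_system (I J : finType) (l : J -> I -> conf -> conf -> R) p x :
  (forall j i, bipoly (l j i)) -> generic p ->
  (forall h : I -> R, (forall j, \sum_i l j i x x * h i = 0) -> forall i, h i = 0) ->
  nearby p (fun q => forall h : I -> R,
    (forall j, \sum_i l j i p q * h i = 0) -> forall i, h i = 0).
Proof.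
move=> bl gp injx.
pose N (p q : conf) : 'M[R]_#|I| :=
  \matrix_(a, b) \sum_j l j (enum_val a) p p * l j (enum_val b) p q.
have bN : bipoly (fun p q => \det (N p q)).
  apply: bipoly_det => a b.
  apply: (@bipoly_ext (fun p q => \sum_j l j (enum_val a) p p * l j (enum_val b) p q)).
    by move=> p' q; rewrite mxE.
  by apply: bipoly_sum => j; apply: bipolyM => //; apply: bipoly_diag.
have Nx : \det (N x x) != 0.
  apply/det0P => -[v v0 vN]; case/negP: v0; apply/eqP/rowP=> a; rewrite mxE.
  pose h i := v 0 (enum_rank i).
  rewrite -(enum_valK a); apply: (injx h) => j {a}.
  have E j' : \sum_i l j' i x x * h i = \sum_a v 0 a * l j' (enum_val a) x x.
    rewrite (reindex (@enum_val I predT)) /=; last first.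
      by apply: onW_bij; apply: enum_val_bij.
    by apply: eq_bigr => a _; rewrite /h enum_valK mulrC.
  (* The sum of squares is v N(x, x) v^T, so a kernel vector of N(x, x) solves the system at (x,
     x). *)
  have S0 : \sum_j (\sum_a v 0 a * l j (enum_val a) x x) ^+ 2 = 0.
    transitivity (\sum_b (v *m N x x) 0 b * v 0 b); last first.
      by rewrite vN big1 // => b _; rewrite mxE mul0r.
    transitivity (\sum_j \sum_b \sum_a
        (v 0 a * l j (enum_val a) x x) * (v 0 b * l j (enum_val b) x x)).
      apply: eq_bigr => j' _; rewrite expr2 mulr_sumr.
      by apply: eq_bigr => b _; rewrite mulr_suml.
    rewrite exchange_big; apply: eq_bigr => b _ /=.
    rewrite exchange_big /= mxE mulr_suml; apply: eq_bigr => a _ /=.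
    rewrite mxE mulr_sumr mulr_suml; apply: eq_bigr => i _.
    by ring.
  apply/eqP; rewrite E -sqrf_eq0; apply/eqP.
  by apply: (psumr_eq0P _ S0) => // i _; rewrite sqr_ge0.
have Np := generic_bipoly_neq0 bN gp Nx.
have eN : 0 < `|\det (N p p)| by rewrite normr_gt0.
apply: nearby_imp (bipoly_continuous p bN eN) => q Hq h Hh i.
have uN : N p q \in unitmx.
  rewrite unitmxE unitfE; apply: contraTneq Hq => ->.
  by rewrite sub0r normrN ltxx.
have : N p q *m (\col_a h (enum_val a)) = 0.
  apply/colP=> a; rewrite !mxE.
  transitivity (\sum_j l j (enum_val a) p p * \sum_i l j i p q * h i); last first.
    by rewrite big1 // => j _; rewrite Hh mulr0.
  under eq_bigr do rewrite !mxE mulr_suml.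
  rewrite exchange_big; apply: eq_bigr => j _ /=; rewrite mulr_sumr.
  rewrite [RHS](reindex (@enum_val I predT)) /=; last first.
    by apply: onW_bij; apply: enum_val_bij.
  by apply: eq_bigr => b _; rewrite mulrA.
move/(congr1 (mulmx (invmx (N p q)))); rewrite mulKmx // mulmx0.
by move/colP/(_ (enum_rank i)); rewrite !mxE enum_rankK.
Qed.

End Configurations.

(** * Nonnegativity of Gram determinants *)

Section Gram.
Variable R : rcfType.

Lemma mulmx_trE m d (X : 'M[R]_(m, d)) i : (X *m X^T) i i = \sum_j X i j ^+ 2.
Proof. by rewrite mxE; apply: eq_bigr => j _; rewrite mxE expr2. Qed.

Lemma mulmx_tr_eq0 m d (X : 'M[R]_(m, d)) : X *m X^T = 0 -> X = 0.
Proof.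
move=> X0; apply/matrixP=> i j; rewrite [RHS]mxE; apply/eqP.
rewrite -sqrf_eq0; apply/eqP; apply: (@psumr_eq0P _ _ xpredT (fun j => X i j ^+ 2)) => //.
  by move=> *; rewrite sqr_ge0.
by rewrite -mulmx_trE X0 mxE.
Qed.

(* If det G < 0, then det ((1 - t) I + t G) vanishes for some 0 <= t < 1 by the
   intermediate value theorem, although that matrix is positive definite. *)
Lemma det_gram_ge0 m d (X : 'M[R]_(m, d)) : 0 <= \det (X *m X^T).
Proof.
set G := X *m X^T; rewrite leNgt; apply/negP => G0.
pose P : {poly R} := - \det ((1 - 'X)%:M + 'X *: map_mx polyC G).
have PE t : P.[t] = - \det ((1 - t)%:M + t *: G).
  rewrite hornerN -horner_evalE -det_map_mx; congr (- \det _).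
  by apply/matrixP=> i j; rewrite !mxE /= /horner_eval hornerD hornerMn hornerM !hornerE.
have [||t /andP[t0 t1] /rootP] := @poly_ivt _ P 0 1; first exact: ler01.
  by rewrite !PE subr0 scale0r addr0 det1 subrr scale1r raddf0 add0r oppr_le0 ler01 oppr_ge0 ltW.
rewrite PE => /eqP; rewrite oppr_eq0 => /det0P[v v0 vM].
have {}t1 : t < 1.
  rewrite lt_neqAle t1 andbT; apply: contraTneq G0 => t1'.
  rewrite -leNgt; suff -> : \det G = 0 by [].
  apply/eqP/det0P; exists v => //; rewrite t1' subrr raddf0 scale1r add0r in vM.
  exact: vM.
(* Pairing with [v] gives (1 - t) |v|^2 + t |v X|^2 = 0, whose first term is positive. *)
have := congr1 (mulmx^~ v^T) vM; rewrite /= mul0mx mulmxDr mulmxDl.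
rewrite mul_mx_scalar -scalemxAr -!scalemxAl.
have -> : v *m G *m v^T = (v *m X) *m (v *m X)^T by rewrite trmx_mul !mulmxA.
move=> /(congr1 (fun w : 'M_1 => w 0 0)) /=.
rewrite mxE [X in X + _]mxE [X in _ + X]mxE [RHS]mxE => E.
have s0 : 0 <= (v *m X *m (v *m X)^T) 0 0.
  by rewrite mulmx_trE sumr_ge0 // => *; rewrite sqr_ge0.
have s1 : 0 < (v *m v^T) 0 0.
  rewrite lt_neqAle eq_sym mulmx_trE sumr_ge0 ?andbT => [|*]; last exact: sqr_ge0.
  apply: contraNneq v0 => E0; apply/eqP/mulmx_tr_eq0/matrixP=> i j.
  by rewrite !ord1 mulmx_trE E0 mxE.
have t1' : 0 < 1 - t by rewrite subr_gt0.
by have := ltr_wpDr (mulr_ge0 t0 s0) (mulr_gt0 t1' s1); rewrite E ltxx.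
Qed.

End Gram.

(** * Volumes in terms of squared distances, and the regular simplex *)

Section Volumes.
Variables (R : realType) (n d : nat).
Notation conf := ('I_n -> 'rV[R]_d).
Implicit Types p q x : conf.

Definition sqdist (p : conf) u v : R := \sum_j (p u 0 j - p v 0 j) ^+ 2.

Lemma sqdistC p u v : sqdist p u v = sqdist p v u.
Proof. by apply: eq_bigr => j _; rewrite -sqrrN opprB. Qed.

Lemma sqdist_polarization p u v w :
  \sum_j (p u 0 j - p w 0 j) * (p v 0 j - p w 0 j) =
  (sqdist p u w + sqdist p v w - sqdist p u v) / 2.
Proof.
rewrite /sqdist -big_split -sumrB mulr_suml; apply: eq_bigr => j _ /=.
by field.
Qed.

Lemma bipoly_sqdist_left u v : bipoly (fun p _ : conf => sqdist p u v).
Proof.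
apply: bipoly_sum => j; apply: bipoly_ext.
  by move=> p q; rewrite expr2; reflexivity.
by apply: bipolyM; apply: bipolyB; apply: bipoly_left.
Qed.

Lemma bipoly_sqdist_right u v : bipoly (fun _ q : conf => sqdist q u v).
Proof. exact: bipoly_swap (bipoly_sqdist_left u v). Qed.

Variable v0 : 'I_n.

(** The volume is a positive constant times the square root of det (X X^T), and [gram_of] is 2 X
    X^T; the root is injective because Gram determinants are nonnegative. *)
Lemma edge_vol_gram p q S : edge_vol p S = edge_vol q S ->
  \det (gram_of v0 (sqdist p) (enum S)) = \det (gram_of v0 (sqdist q) (enum S)).
Proof.
rewrite /edge_vol; set s := enum S.
pose X (p : conf) : 'M[R]_((size s).-1, d) :=
  \matrix_(i, j) (p (nth v0 s i.+1) 0 j - p (nth v0 s 0) 0 j).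
have VE p' : Vol [seq p' v | v <- s] =
    ((size s).-1)`!%:R^-1 * Num.sqrt (\det (X p' *m (X p')^T)).
  rewrite /Vol /wedge_norm size_map; congr (_ * Num.sqrt (\det _)).
  apply/matrixP=> i j; rewrite !mxE /dotv mxE; apply: eq_bigr => l _.
  have lt_s (a : 'I_(size s).-1) : (a.+1 < size s)%N by case: a; case: (s).
  have s0 : (0 < size s)%N by apply: leq_trans (lt_s i).
  by rewrite !(nth_map v0) // !mxE.
have GE p' : gram_of v0 (sqdist p') s = 2 *: (X p' *m (X p')^T).
  apply/matrixP=> i j; rewrite !mxE.
  under [in RHS]eq_bigr do rewrite !mxE.
  by rewrite sqdist_polarization; field.
rewrite !VE !GE !detZ => /mulfI E; congr (_ * _); apply/eqP.
by rewrite -eqr_sqrt ?det_gram_ge0 // E // invr_eq0 pnatr_eq0 -lt0n fact_gt0.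
Qed.

Lemma bipoly_gram_diff s (g : 'I_n -> 'I_n -> R) :
  (forall u v, bipoly (fun _ _ : conf => g u v)) ->
  bipoly (fun p q : conf => gram_diff v0 (sqdist p) (sqdist q) s g).
Proof.
move=> bg.
have bG (D : conf -> conf -> 'I_n -> 'I_n -> R) i j :
    (forall u v, bipoly (fun p q => D p q u v)) ->
    bipoly (fun p q => gram_of v0 (D p q) s i j).
  move=> bD; pose e k := nth v0 s k.
  apply: bipoly_ext (bipolyB (bipolyD (bD (e i.+1) (e 0)) (bD (e j.+1) (e 0)))
    (bD (e i.+1) (e j.+1))) => p q.
  by rewrite mxE.
apply: bipoly_sum => i; apply: bipoly_sum => j; apply: bipolyM.
  exact: (bG (fun _ _ => g)).
apply: bipoly_cofactor => a b.
have [ai|ia] := ltnP a i.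
  apply: (@bipoly_ext _ _ _ (fun p q => gram_of v0 (sqdist p) s a b)).
    by move=> p q; rewrite [RHS]mxE ai.
  by apply: (bG (fun p _ => sqdist p)) => u v; apply: bipoly_sqdist_left.
apply: (@bipoly_ext _ _ _ (fun p q => gram_of v0 (sqdist q) s a b)).
  by move=> p q; rewrite [RHS]mxE ltnNge ia.
by apply: (bG (fun _ q => sqdist q)) => u v; apply: bipoly_sqdist_right.
Qed.

Lemma regular_simplex (T : {set 'I_n}) : (0 < d)%N -> #|T| = d.+1 ->
  exists x : conf, {in T &, forall u v, sqdist x u v = 2 * (u != v)%:R}.
Proof.
(* The vertices are the d unit vectors and (c, ..., c), whose squared distance
   to each unit vector is (c - 1)^2 + (d - 1) c^2 = 2. *)
move=> d0 cT; pose c : R := (1 + Num.sqrt (d%:R + 1)) / d%:R.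
have dn0 : d%:R != 0 :> R by rewrite pnatr_eq0 -lt0n.
have cE : d%:R * c ^+ 2 - 2 * c = 1.
  have : Num.sqrt (d%:R + 1) ^+ 2 = d%:R + 1 :> R by rewrite sqr_sqrtr // addr_ge0.
  rewrite /c; move: (Num.sqrt _) => r rE.
  have -> : d%:R * ((1 + r) / d%:R) ^+ 2 - 2 * ((1 + r) / d%:R) = (r ^+ 2 - 1) / d%:R by field.
  by rewrite rE addrK divff.
(* Numbers the points of [T] from 0 to d; number d is sent to (c, ..., c). *)
pose f v := index v (enum T).
have fd v : v \in T -> (f v <= d)%N.
  by move=> vT; rewrite -ltnS -cT cardE index_mem mem_enum.
have finj : {in T &, injective f}.
  move=> u v uT vT E; rewrite -(nth_index v0 (_ : u \in enum T)) ?mem_enum //.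
  by rewrite -/(f u) E nth_index // mem_enum.
pose x v : 'rV[R]_d := \row_j (if f v == d then c else (f v == j)%:R).
exists x => u v uT vT.
have [<-|uv] := eqVneq u v.
  by rewrite /sqdist big1 ?mulr0 // => j _; rewrite subrr expr0n.
have fuv : f u != f v by apply: contraNneq uv => /finj->.
rewrite mulr1.
have H a b : a \in T -> b \in T -> f a = d -> f b != d -> sqdist x a b = 2.
  move=> aT bT fa fb; have fb' : (f b < d)%N by rewrite ltn_neqAle fb fd.
  rewrite /sqdist (bigD1 (Ordinal fb')) //= !mxE fa eqxx (negPf fb) eqxx.
  rewrite (eq_bigr (fun=> c ^+ 2)) => [|j jb]; last first.
    rewrite !mxE fa eqxx (negPf fb) (_ : (f b == j) = false) ?subr0 //.
    by apply/negbTE; apply: contraNneq jb => E; apply/eqP/val_inj.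
  rewrite sumr_const cardC1 card_ord -[X in _ + X]mulr_natr.
  have -> : d.-1%:R = d%:R - 1 :> R by rewrite -[in RHS](prednK d0) -addn1 natrD addrK.
  by move: cE => /=; lra.
have [fu|fu] := eqVneq (f u) d; first by apply: H => //; rewrite -fu eq_sym.
have [fv|fv] := eqVneq (f v) d; first by rewrite sqdistC; apply: H.
have fu' : (f u < d)%N by rewrite ltn_neqAle fu fd.
have fv' : (f v < d)%N by rewrite ltn_neqAle fv fd.
rewrite /sqdist (bigD1 (Ordinal fu')) //= (bigD1 (Ordinal fv')) /=; last first.
  by rewrite -val_eqE /= eq_sym.
rewrite big1 ?addr0 => [|j /andP[ju jv]]; last first.
  rewrite !mxE (negPf fu) (negPf fv) -!val_eqE /= in ju jv *.
  by rewrite ![_ == val j]eq_sym (negPf ju) (negPf jv) subrr expr0n.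
rewrite !mxE (negPf fu) (negPf fv) /= !eqxx (negPf fuv) eq_sym (negPf fuv).
by rewrite /=; ring.
Qed.

End Volumes.

(** * From volumes to distances, and from distances to congruence *)

Section Rigidity.
Variables (R : realType) (n d : nat).
Notation conf := ('I_n -> 'rV[R]_d).
Implicit Types p q x : conf.
Variable v0 : 'I_n.

Definition frame p : 'M[R]_(n, d) := \matrix_(v, j) (p v 0 j - p v0 0 j).

(** Says that [p] affinely spans the space. The witness sends vertex 0 to the origin and vertex j +
    1 to the j-th unit vector, so that X^T X = 1. *)
Lemma generic_frame p : v0 = 0 :> nat -> (d < n)%N -> generic p ->
  (frame p)^T *m frame p \in unitmx.
Proof.
move=> v00 dn gp; rewrite unitmxE unitfE.
pose x (v : 'I_n) : 'rV[R]_d := \row_j (v == j.+1 :> nat)%:R.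
apply: (generic_bipoly_neq0 (F := fun p _ => \det ((frame p)^T *m frame p)) (x := x)) => //.
  apply: bipoly_det => i j.
  apply: (@bipoly_ext _ _ _ (fun p _ =>
      \sum_v (p v 0 i - p v0 0 i) * (p v 0 j - p v0 0 j))) => [p' _|].
    by rewrite mxE; apply: eq_bigr => v _; rewrite !mxE.
  by apply: bipoly_sum => v; apply: bipolyM; apply: bipolyB; apply: bipoly_left.
suff -> : (frame x)^T *m frame x = 1%:M by rewrite det1 oner_eq0.
apply/matrixP=> i j; rewrite !mxE.
have lti : (i.+1 < n)%N by apply: leq_ltn_trans dn.
rewrite (bigD1 (Ordinal lti)) //= big1 ?addr0 => [|v vi].
  by rewrite !mxE v00 !subr0 /= eqxx mul1r eqSS.
by rewrite !mxE v00 !subr0 -val_eqE /= in vi *; rewrite (negPf vi) mul0r.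
Qed.

(** By polarization X X^T = Y Y^T. With Z a left inverse of X, the matrix A = Z Y is orthogonal, and
    (X A - Y)(X A - Y)^T = 0 yields X A = Y. *)
Lemma congruent_of_sqdist p q : (frame p)^T *m frame p \in unitmx ->
  (forall u v, sqdist p u v = sqdist q u v) -> congruent p q.
Proof.
move=> uX D; pose X := frame p; pose Y := frame q.
have XY : X *m X^T = Y *m Y^T.
  apply/matrixP=> u v; rewrite !mxE.
  under eq_bigr do rewrite !mxE.
  under [RHS]eq_bigr do rewrite !mxE.
  by rewrite !sqdist_polarization !D.
pose Z := invmx (X^T *m X) *m X^T.
have ZX : Z *m X = 1%:M by rewrite -mulmxA mulVmx.
pose A := Z *m Y.
have AA : A *m A^T = 1%:M.
  by rewrite trmx_mul mulmxA -(mulmxA Z) -XY mulmxA ZX mul1mx -trmx_mul ZX trmx1.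
have XA : X *m A = Y.
  apply/eqP; rewrite -subr_eq0; apply/eqP/mulmx_tr_eq0.
  have -> : X *m A - Y = (X *m Z - 1%:M) *m Y by rewrite mulmxBl mul1mx !mulmxA.
  rewrite trmx_mul mulmxA -(mulmxA _ Y) -XY mulmxA [_ *m X]mulmxBl.
  by rewrite -(mulmxA X Z X) ZX mulmx1 mul1mx subrr !mul0mx.
exists A, (q v0 - p v0 *m A); split; first exact: mulmx1C.
move=> v; have := congr1 (row v) XA; rewrite row_mul.
have rE p' : row v (frame p') = p' v - p' v0 by apply/rowP=> j; rewrite !mxE.
by rewrite !rE mulmxBl => E; rewrite addrCA E addrC subrK.
Qed.

Let pair_fun (c : 'I_n * 'I_n) (u v : 'I_n) : R := (c == (u, v))%:R + (c == (v, u))%:R.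

Let pair_fun_sum (h : 'I_n * 'I_n -> R) u v :
  \sum_c h c * pair_fun c u v = h (u, v) + h (v, u).
Proof.
under eq_bigr do rewrite mulrDr; rewrite big_split /=; congr (_ + _).
  by rewrite (bigD1 (u, v)) //= eqxx mulr1 big1 ?addr0 // => c /negPf->; rewrite mulr0.
by rewrite (bigD1 (v, u)) //= eqxx mulr1 big1 ?addr0 // => c /negPf->; rewrite mulr0.
Qed.

(** Applies [generic_linear_system] to the hyperedges inside [T], with [x] a regular simplex on [T];
    k < d gives k + 2 <= |T|. *)
Lemma nearby_sqdist (k : nat) (T : {set 'I_n}) p : (2 <= k)%N -> (k < d)%N ->
  #|T| = d.+1 -> generic p ->
  nearby p (fun q => volume_equivalent (@complete_edge n k) p q ->
    {in T &, forall u v, sqdist p u v = sqdist q u v}).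
Proof.
move=> k2 kd cT gp.
have d0 : (0 < d)%N by apply: leq_ltn_trans kd.
have [x xT] := regular_simplex R v0 d0 cT.
(* The unknowns are indexed by all ordered pairs; the equations [inr c'] kill
   those that do not represent an unordered pair of distinct points of T. *)
pose good (c : 'I_n * 'I_n) := [&& (c.1 < c.2)%N, c.1 \in T & c.2 \in T].
pose edge (S : {set 'I_n}) := (S \subset T) && (#|S| == k).
pose l (e : {set 'I_n} + 'I_n * 'I_n) c p q : R :=
  match e with
  | inl D =>
    if edge D then gram_diff v0 (sqdist p) (sqdist q) (enum D) (pair_fun c) else 0
  | inr c' => if good c' then 0 else (c == c')%:R
  end.
have lS S h p' q' : edge S -> \sum_c l (inl S) c p' q' * h c =
    gram_diff v0 (sqdist p') (sqdist q') (enum S) (fun u v => h (u, v) + h (v, u)).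
  move=> eS; rewrite /l eS -gram_diff_sum; apply: gram_diff_ext => u v _ _.
  by rewrite pair_fun_sum.
have lc c' h p' q' : \sum_c l (inr c') c p' q' * h c = if good c' then 0 else h c'.
  rewrite /l; case: ifP => _; first by rewrite big1 // => c _; rewrite mul0r.
  by rewrite (bigD1 c') //= eqxx mul1r big1 ?addr0 // => c /negPf->; rewrite mul0r.
have bl e c : bipoly (l e c).
  have b0 : bipoly (fun _ _ : conf => 0 : R) by apply: bipoly_int 0.
  have bb (b : bool) : bipoly (fun _ _ : conf => b%:R : R) by apply: bipoly_int b.
  rewrite /l; case: e => [S|c']; last by case: (good c').
  case: (edge S) => //; apply: bipoly_gram_diff => u v.
  exact: bipolyD (bb (c == (u, v))) (bb (c == (v, u))).
have inj h : (forall e, \sum_c l e c x x * h c = 0) -> forall c, h c = 0.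
  move=> H.
  have hbad c : ~~ good c -> h c = 0.
    by move=> /negPf gc; have := H (inr c); rewrite lc gc.
  pose g u v := h (u, v) + h (v, u).
  have g0 u : g u u = 0 by rewrite /g hbad ?addr0 // /good ltnn.
  have gC u v : g u v = g v u by rewrite /g addrC.
  have gT : {in T &, forall u v, g u v = 0}.
    apply: (@pair_sum_inj _ _ _ _ k) => //; first by rewrite cT addn2 ltnS.
    move=> S ST cS.
    have eS : edge S by rewrite /edge ST cS eqxx.
    have HS := H (inl S); rewrite lS // in HS.
    rewrite -[RHS](@gram_diff_regular _ _ v0 (sqdist x) (enum S) g) ?enum_uniq //.
    - by rewrite big_enum; apply: eq_bigr => u _; rewrite big_enum.
    - by move=> u v; rewrite !mem_enum => uS vS; apply: xT; apply: (subsetP ST).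
  (* If (u, v) is good then (v, u) is not, so [h (u, v)] is [g u v]. *)
  case=> u v; have [/and3P[/= uv uT vT]|/hbad//] := boolP (good (u, v)).
  by have := gT u v uT vT; rewrite /g [X in _ + X]hbad ?addr0 // /good /= ltnNge ltnW.
apply: nearby_imp (generic_linear_system bl gp inj) => q Hq vol.
(* Each difference of squared distances is stored at the good orientation only, so symmetrizing
   recovers it once. *)
pose h (c : 'I_n * 'I_n) := if good c then sqdist p c.1 c.2 - sqdist q c.1 c.2 else 0.
have hE : {in T &, forall u v, h (u, v) + h (v, u) = sqdist p u v - sqdist q u v}.
  move=> u v uT vT; rewrite /h /good /= uT vT !andbT.
  case: ltngtP => [uv|vu|/val_inj->]; rewrite ?addr0 ?add0r //.
    by rewrite (sqdistC p) (sqdistC q).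
  by rewrite /sqdist !big1 ?subrr // => j _; rewrite subrr expr0n.
have h0 : forall c, h c = 0.
  apply: Hq => -[S|c]; last by rewrite lc /h; case: (good c).
  have [eS|neS] := boolP (edge S); last first.
    by rewrite big1 // => c _; rewrite /l (negPf neS) mul0r.
  have /andP[ST cS] := eS; rewrite lS //.
  rewrite (@gram_diff_ext _ _ _ _ _ _ (fun u v => sqdist p u v - sqdist q u v)).
    rewrite -gram_diffE; apply/eqP; rewrite subr_eq0; apply/eqP.
    by apply: edge_vol_gram; apply: vol.
  by move=> u v; rewrite !mem_enum => uS vS; apply: hE; apply: (subsetP ST).
move=> u v uT vT; apply/eqP; rewrite -subr_eq0 -hE //.
by rewrite !h0 addr0.
Qed.

End Rigidity.

Theorem theorem2p3 (R : realType) (n d k : nat)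
  (hk : (2 <= k)%N) (hkd : (k <= d.-1)%N) (hdn : (d.-1 <= n - 2)%N)
  (p : 'I_n -> 'rV[R]_d) (hp : generic p) :
  volume_rigid (@complete_edge n k) p.
Proof.
(* Since k >= 2, the truncated [d.-1] and [n - 2] are positive, hence genuine differences. *)
have kd : (k < d)%N by lia.
have dn : (d < n)%N by lia.
pose v0 : 'I_n := Ordinal (leq_ltn_trans (leq0n d) dn).
(* There are finitely many [T], so one neighbourhood serves them all. *)
have := nearby_all (fun T : {T : {set 'I_n} | #|T| == d.+1} =>
  nearby_sqdist v0 hk kd (eqP (valP T)) hp).
apply: nearby_imp => q Hq vol.
apply: (@congruent_of_sqdist _ _ _ v0); first exact: generic_frame.
move=> u v; have [||T [uvT _ cT]] := @exists_set_between _ [set u; v] [set: 'I_n] d.+1.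
- exact: subsetT.
- by rewrite cardsT card_ord dn andbT cards2; case: (u != v) => //=; lia.
have cT' : #|T| == d.+1 by apply/eqP.
by apply: (Hq (exist _ T cT') vol); apply: (subsetP uvT); rewrite !inE eqxx ?orbT.
Qed.
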